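(* Let $I\subseteq\mathbb{R}$ be a nonempty open interval and let $f:I\to\mathbb{R}$ be a function. Let $\lambda_1,\lambda_2,\lambda_3,\lambda_4\in[0,1]$ be such that $\lambda_1+\lambda_2+\lambda_3+\lambda_4=1$. (i) With $\omega_4:=\mathrm{e}^{\frac{2\pi}{4}\mathrm{i}}$, the condition $$\sum_{j=1}^4\lambda_j\omega_4^{k(j-1)}\neq0\quad\text{for all } k\in\{1,2,3\}$$ is equivalent to $$(\lambda_1-\lambda_3)^2+(\lambda_2-\lambda_4)^2>0\qquad\text{and}\qquad\lambda_1+\lambda_3\neq\lambda_2+\lambda_4.$$ (ii) If $\lambda_1,\lambda_2,\lambda_3,\lambda_4$ are not all equal to each other (i.e., not all of them are equal to $\frac14$) and the inequality $$\begin{aligned}f\left(\frac{x_1+x_2+x_3+x_4}{4}\right)\leq\frac14\Big(&f(\lambda_1x_1+\lambda_2x_2+\lambda_3x_3+\lambda_4x_4)+f(\lambda_2x_1+\lambda_3x_2+\lambda_4x_3+\lambda_1x_4)\\&+f(\lambda_3x_1+\lambda_4x_2+\lambda_1x_3+\lambda_2x_4)+f(\lambda_4x_1+\lambda_1x_2+\lambda_2x_3+\lambda_3x_4)\Big)\end{aligned}$$ holds for all $x_1,x_2,x_3,x_4\in I$, then $f$ is Jensen convex on $I$.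
   Context: $\mathrm{i}$ is the imaginary unit. A function $f:I\to\mathbb{R}$ is Jensen convex on $I$ if $f\left(\frac{x+y}{2}\right)\leq\frac{f(x)+f(y)}{2}$ for all $x,y\in I$. *)

(* Defs.v *)
From mathcomp Require Import all_boot all_order all_algebra.
From mathcomp Require Import all_classical all_reals all_analysis.
From mathcomp Require Export complex.
Set Implicit Arguments.
Unset Strict Implicit.
Unset Printing Implicit Defensive.
Import Order.TTheory GRing.Theory Num.Theory.
Import numFieldNormedType.Exports.
Local Open Scope classical_set_scope.
Local Open Scope ring_scope.
Local Open Scope complex_scope.

Definition cexp (R : realType) (z : R[i]) : R[i] :=
  let: a +i* b := z in (expR a)%:C * (cos b +i* sin b).

Definition omega4 (R : realType) : R[i] :=
  cexp ((2 * pi / 4)%:C * 'i).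

(* A function on a set I is a total function; its values outside I are
   irrelevant. When I is an interval, the midpoint is again in I. *)
Definition Jensen_convex_on (R : realType) (I : set R) (f : R -> R) : Prop :=
  forall x y : R, I x -> I y -> f ((x + y) / 2) <= (f x + f y) / 2.

(* Main.v *)
Require Import Defs.
From mathcomp Require Import all_boot all_order all_algebra.
From mathcomp Require Import all_classical all_reals all_analysis.
From mathcomp Require Import ring lra zify.
Import Order.TTheory GRing.Theory Num.Theory.
Import numFieldNormedType.Exports.
Local Open Scope classical_set_scope.
Local Open Scope ring_scope.
Local Open Scope complex_scope.

(** Both parts rest on the three nontrivial Fourier coefficients of [lam] on
    the cyclic group of order 4: up to conjugation they are
    [(lam 1 - lam 3) + i (lam 2 - lam 4)] and
    [lam 1 - lam 2 + lam 3 - lam 4], which is part (i) once [omega4] is known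
    to be [i].

    For part (ii) the circulant matrix of [lam] need not be invertible. It is
    enough to make its four rows take the values [1] and [-1], twice each, at
    some vector [t] of sum [0]: putting [x_i = m + h * t_i] in the hypothesis
    then gives the midpoint inequality [f m <= (f (m - h) + f (m + h)) / 2].
    If [lam 1 + lam 3 <> lam 2 + lam 4], a multiple of [(1, -1, 1, -1)] will
    do, being an eigenvector with nonzero eigenvalue. Otherwise the
    coefficient with [c = lam 1 - lam 3], [d = lam 2 - lam 4] is nonzero, and
    [t = (s, r, -s, -r)] will do for the solution of [c s + d r = 1],
    [d s - c r = -1], a system with determinant [- (c ^+ 2 + d ^+ 2)]. One of
    the two cases occurs as soon as the weights are not all equal
    ([circulant_balanced_vector]).

    The points [m + h * t_i] have to lie in [I], so the midpoint inequality is
    available only when the interval of radius [T * h] around [m] is inside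
    [I], where [T] bounds the [|t_i|]. This is enough because Jensen convexity
    is a local property on an open interval: a fine subdivision of a segment
    turns short midpoint inequalities into the long one
    ([Jensen_convex_on_of_margin]). *)

Lemma omega4E (R : realType) : omega4 R = 'i.
Proof.
have -> : omega4 R = cexp (0 +i* (2 * pi / 4)).
  by rewrite /omega4; congr cexp; simpc.
rewrite /cexp expR0; have -> : 2 * pi / 4 = pi / 2 :> R by lra.
by rewrite cos_pihalf sin_pihalf; simpc.
Qed.

Lemma dft4E (R : realType) (lam : nat -> R) (k : nat) :
  \sum_(1 <= j < 5) (lam j)%:C * omega4 R ^+ (k * (j - 1)) =
  (lam 1%N)%:C + (lam 2%N)%:C * 'i ^+ k
  + (lam 3%N)%:C * ('i ^+ k) ^+ 2 + (lam 4%N)%:C * ('i ^+ k) ^+ 3.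
Proof.
rewrite omega4E 4?big_ltn // big_geq // addr0 !exprM !subSS !subn0 expr0.
by rewrite mulr1 expr1 !addrA.
Qed.

Lemma dft4_1 (R : realType) (lam : nat -> R) :
  \sum_(1 <= j < 5) (lam j)%:C * omega4 R ^+ (1 * (j - 1)) =
  (lam 1%N - lam 3%N) +i* (lam 2%N - lam 4%N).
Proof. rewrite dft4E expr1 !exprS expr0; simpc; congr (_ +i* _); ring. Qed.

Lemma dft4_2 (R : realType) (lam : nat -> R) :
  \sum_(1 <= j < 5) (lam j)%:C * omega4 R ^+ (2 * (j - 1)) =
  (lam 1%N + lam 3%N - (lam 2%N + lam 4%N)) +i* 0.
Proof. rewrite dft4E !exprS expr0; simpc; congr (_ +i* _); ring. Qed.

Lemma dft4_3 (R : realType) (lam : nat -> R) :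
  \sum_(1 <= j < 5) (lam j)%:C * omega4 R ^+ (3 * (j - 1)) =
  (lam 1%N - lam 3%N) +i* (lam 4%N - lam 2%N).
Proof. rewrite dft4E !exprS expr0; simpc; congr (_ +i* _); ring. Qed.

Lemma dft4_neq0 (R : realType) (lam : nat -> R) :
  (forall k : nat, (1 <= k <= 3)%N ->
     \sum_(1 <= j < 5) (lam j)%:C * omega4 R ^+ (k * (j - 1)) <> 0) <->
  (0 < (lam 1%N - lam 3%N) ^+ 2 + (lam 2%N - lam 4%N) ^+ 2 /\
   lam 1%N + lam 3%N <> lam 2%N + lam 4%N).
Proof.
split=> [dft_neq0|[sqr_gt0 sum_neq]].
  split.
    rewrite lt0r addr_ge0 ?paddr_eq0 ?sqr_ge0 // andbT.
    rewrite !sqrf_eq0; apply/negP => /andP[/eqP c0 /eqP d0].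
    by apply: (dft_neq0 1%N) => //; rewrite dft4_1 c0 d0.
  move=> sum_eq; apply: (dft_neq0 2%N) => //.
  by rewrite dft4_2 sum_eq subrr.
case=> [|[|[|[|k]]]] // _.
- rewrite dft4_1 => -[c0 d0].
  by move: sqr_gt0; rewrite c0 d0 !expr0n addr0 ltxx.
- by rewrite dft4_2 => -[/eqP]; rewrite subr_eq0 => /eqP.
- rewrite dft4_3 => -[c0 d0].
  have d0' : lam 2%N - lam 4%N = 0 by rewrite -opprB d0 oppr0.
  by move: sqr_gt0; rewrite c0 d0' !expr0n addr0 ltxx.
Qed.

(** Reflecting about the middle index and adding, the symmetric sums
    [a (n - j) + a (n + j)] form a convex sequence whose first step is
    nonnegative, hence they are nondecreasing in [j]. *)
Lemma convex_seq_middle (R : realFieldType) (n : nat) (a : nat -> R) :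
  (forall k, (0 < k < n + n)%N -> a k <= (a k.-1 + a k.+1) / 2) ->
  a n <= (a 0%N + a (n + n)%N) / 2.
Proof.
move=> a_conv; pose b j := a (n - j)%N + a (n + j)%N.
have b_step j : (j < n)%N -> b j <= b j.+1.
  elim: j => [|j IHj] lt_jn.
    have := a_conv n; rewrite /b subn0 addn0 subn1 addn1.
    have -> : (0 < n < n + n)%N by lia.
    by move=> /(_ isT); lra.
  have {}IHj := IHj (ltnW lt_jn).
  have aL := a_conv (n - j.+1)%N; have aR := a_conv (n + j.+1)%N.
  have rL : (0 < n - j.+1 < n + n)%N by lia.
  have rR : (0 < n + j.+1 < n + n)%N by lia.
  move: {aL aR rL rR} (aL rL) (aR rR) IHj; rewrite /b.
  have -> : (n - j.+1).-1 = (n - j.+2)%N by lia.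
  have -> : (n - j.+1).+1 = (n - j)%N by lia.
  have -> : (n + j.+1).-1 = (n + j)%N by lia.
  have -> : (n + j.+1).+1 = (n + j.+2)%N by lia.
  by move=> aL aR IHj; lra.
have b_mono j : (j <= n)%N -> b 0%N <= b j.
  elim: j => [|j IHj] le_jn //.
  exact: le_trans (IHj (ltnW le_jn)) (b_step _ le_jn).
by have := b_mono n (leqnn n); rewrite /b subn0 addn0 subnn; lra.
Qed.

Lemma is_intervalW (R : realType) (I : set R) (x y z : R) :
  is_interval I -> I x -> I y -> x <= z -> z <= y -> I z.
Proof. by move=> I_itv Ix Iy xz zy; apply: (I_itv x y); rewrite ?xz ?zy. Qed.

(** Divide the segment into [2 n] steps of length [h] and apply
    [convex_seq_middle] to the values at the division points. Openness gives
    some room around the endpoints, so that for large [n] the margin [T * h]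
    also fits in [I] at the division points next to them. *)
Lemma Jensen_convex_on_of_margin (R : realType) (I : set R) (f : R -> R)
    (T : R) :
  is_interval I -> open I -> 0 <= T ->
  (forall m h : R, 0 <= h -> I (m - T * h) -> I (m + T * h) ->
     f m <= (f (m - h) + f (m + h)) / 2) ->
  Jensen_convex_on I f.
Proof.
move=> I_itv I_open T0 f_mid x y.
wlog xy : x y / x <= y => [hwlog Ix Iy|Ix Iy].
  have [xy|/ltW yx] := leP x y; first exact: hwlog.
  by rewrite addrC [f x + _]addrC; exact: hwlog.
have room (z : R) : I z -> exists2 e : R, 0 < e & I (z - e) /\ I (z + e).
  move=> Iz; have /nbhs_ballP[e /= e0 be] := open_nbhs_nbhs (conj I_open Iz).
  have e20 : 0 < e / 2 by rewrite divr_gt0.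
  exists (e / 2) => //.
  by split; apply: be; rewrite /ball /= ?opprD ?opprK ?addrA subrr
    ?add0r ?normrN gtr0_norm //; lra.
have [e1 e10 [Ixe _]] := room x Ix; have [e2 e20 [_ Iye]] := room y Iy.
pose e := Num.min e1 e2.
have e0 : 0 < e by rewrite lt_min e10.
have le_e1 : e <= e1 by rewrite ge_min lexx.
have le_e2 : e <= e2 by rewrite ge_min lexx orbT.
have q0 : 0 <= T * (y - x) / e.
  by rewrite divr_ge0 ?(ltW e0) // mulr_ge0 ?subr_ge0.
have [n n0 lt_n] : exists2 n : nat, 0 < n%:R :> R & T * (y - x) / e < n%:R.
  exists (Num.bound (T * (y - x) / e)); last exact: archi_boundP.
  exact: le_lt_trans q0 (archi_boundP q0).
pose h := (y - x) / (2 * n%:R).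
have h0 : 0 <= h by rewrite divr_ge0 ?subr_ge0 // mulr_ge0 // ltW.
have nhE : n%:R * h = (y - x) / 2 by rewrite /h; field; rewrite gt_eqF.
have Th_le : T * h <= e.
  move: lt_n; rewrite ltr_pdivrMr // => lt_n.
  rewrite -(ler_pM2l n0) mulrCA nhE.
  have : 0 < n%:R * e by rewrite mulr_gt0.
  by lra.
have := convex_seq_middle R n (fun k => f (x + k%:R * h)).
rewrite /= mul0r addr0 natrD (mulrDl _ _ h) nhE.
have -> : x + (y - x) / 2 = (x + y) / 2 by lra.
have -> : x + ((y - x) / 2 + (y - x) / 2) = y by lra.
apply=> k /andP[k0 lt_k].
have kh0 : 0 <= k%:R * h by rewrite mulr_ge0.
have kh1 : k%:R * h <= y - x.
  have -> : y - x = (n + n)%:R * h by rewrite natrD mulrDl nhE; lra.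
  by rewrite ler_wpM2r // ler_nat ltnW.
have Th0 : 0 <= T * h by rewrite mulr_ge0.
have := f_mid (x + k%:R * h) h h0.
have -> : x + k%:R * h - h = x + k.-1%:R * h.
  by rewrite -[in LHS](prednK k0) -natr1; ring.
have -> : x + k%:R * h + h = x + k.+1%:R * h by rewrite -natr1; ring.
by apply; apply: (is_intervalW _ _ _ _ _ I_itv Ixe Iye); lra.
Qed.

(** For weights of sum [1], a vector [t] of sum [0] moves the four weighted
    means of the points [m + h * t_i] away from [m] by [h] times the entries
    of its image under the circulant matrix. The sign [u] records how the
    values [1] and [-1] are distributed: [u = 1] for the multiples of
    [(1, -1, 1, -1)] and [u = -1] for the vector [(s, r, -s, -r)]. *)
Lemma circulant_balanced_vector (R : realFieldType) (l1 l2 l3 l4 : R) :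
  ~ (l1 = l2 /\ l2 = l3 /\ l3 = l4) ->
  exists t1 t2 t3 t4 u : R,
    [/\ t1 + t2 + t3 + t4 = 0, u = 1 \/ u = -1 &
     [/\ l1 * t1 + l2 * t2 + l3 * t3 + l4 * t4 = 1,
         l2 * t1 + l3 * t2 + l4 * t3 + l1 * t4 = -1,
         l3 * t1 + l4 * t2 + l1 * t3 + l2 * t4 = u &
         l4 * t1 + l1 * t2 + l2 * t3 + l3 * t4 = - u]].
Proof.
move=> l_neq; have [e0|e_neq0] := eqVneq (l1 + l3 - (l2 + l4)) 0; last first.
  pose q := (l1 + l3 - (l2 + l4))^-1.
  exists q, (- q), q, (- q), 1.
  by split; [lra|left|split; rewrite /q; field; exact: e_neq0].
pose c := l1 - l3; pose d := l2 - l4.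
have N_neq0 : c ^+ 2 + d ^+ 2 != 0.
  rewrite paddr_eq0 ?sqr_ge0 // !sqrf_eq0 /c /d.
  by apply/negP => /andP[/eqP c0 /eqP d0]; apply: l_neq; lra.
(* Cramer's rule for [row1] and [row2]. *)
pose s := (c - d) / (c ^+ 2 + d ^+ 2); pose r := (c + d) / (c ^+ 2 + d ^+ 2).
have row1 : c * s + d * r = 1 by rewrite /s /r; field.
have row2 : d * s - c * r = -1 by rewrite /s /r; field.
exists s, r, (- s), (- r), (-1).
split; [lra|by right|].
by move: row1 row2; rewrite /c /d => row1 row2; split; lra.
Qed.

(* The family lam is used only at the indices 1, 2, 3, 4. *)
Theorem proposition3p7 (R : realType) (I : set R) (f : R -> R)
    (lam : nat -> R)
    (I_itv : is_interval I) (I_open : open I) (I_neq0 : I !=set0)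
    (lam01 : forall j : nat, (1 <= j <= 4)%N -> 0 <= lam j <= 1)
    (lam_sum : lam 1%N + lam 2%N + lam 3%N + lam 4%N = 1) :
  ((forall k : nat, (1 <= k <= 3)%N ->
      \sum_(1 <= j < 5) (lam j)%:C * omega4 R ^+ (k * (j - 1)) <> 0)
   <->
   (0 < (lam 1%N - lam 3%N) ^+ 2 + (lam 2%N - lam 4%N) ^+ 2 /\
    lam 1%N + lam 3%N <> lam 2%N + lam 4%N))
  /\
  (~ (lam 1%N = lam 2%N /\ lam 2%N = lam 3%N /\ lam 3%N = lam 4%N) ->
   (forall x1 x2 x3 x4 : R, I x1 -> I x2 -> I x3 -> I x4 ->
      f ((x1 + x2 + x3 + x4) / 4) <=
      1 / 4 *
      (f (lam 1%N * x1 + lam 2%N * x2 + lam 3%N * x3 + lam 4%N * x4) +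
       f (lam 2%N * x1 + lam 3%N * x2 + lam 4%N * x3 + lam 1%N * x4) +
       f (lam 3%N * x1 + lam 4%N * x2 + lam 1%N * x3 + lam 2%N * x4) +
       f (lam 4%N * x1 + lam 1%N * x2 + lam 2%N * x3 + lam 3%N * x4))) ->
   Jensen_convex_on I f).
Proof.
split; first exact: dft4_neq0.
move=> /(circulant_balanced_vector R)[t1 [t2 [t3 [t4 [u [t_sum u_sign]]]]]].
move=> [row1 row2 row3 row4] f_ineq.
pose T := `|t1| + `|t2| + `|t3| + `|t4|.
have T0 : 0 <= T by rewrite !addr_ge0.
apply: (Jensen_convex_on_of_margin _ _ _ _ I_itv I_open T0) => m h h0 ImL ImR.
have I_pt t : `|t| <= T -> I (m + h * t).
  rewrite ler_norml => /andP[tL tR].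
  have thL := ler_wpM2r h0 tL; have thR := ler_wpM2r h0 tR.
  by apply: (is_intervalW _ _ _ _ _ I_itv ImL ImR); lra.
have n1 := normr_ge0 t1; have n2 := normr_ge0 t2.
have n3 := normr_ge0 t3; have n4 := normr_ge0 t4.
have := f_ineq (m + h * t1) (m + h * t2) (m + h * t3) (m + h * t4).
have mean : (m + h * t1 + (m + h * t2) + (m + h * t3) + (m + h * t4)) / 4 = m.
  transitivity (m + h * (t1 + t2 + t3 + t4) / 4); first by field.
  by rewrite t_sum mulr0 mul0r addr0.
have shift a b c d : a + b + c + d = 1 ->
    a * (m + h * t1) + b * (m + h * t2) + c * (m + h * t3) + d * (m + h * t4)
    = m + h * (a * t1 + b * t2 + c * t3 + d * t4).
  move=> abcd; rewrite -[m in RHS]mul1r -abcd; ring.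
rewrite mean !shift ?row1 ?row2 ?row3 ?row4; try by rewrite -lam_sum; ring.
rewrite !mulrN !mulr1 => f_m; have {f_m} := f_m (I_pt t1 _) (I_pt t2 _) (I_pt t3 _) (I_pt t4 _).
have pair : f (m + h * u) + f (m - h * u) = f (m - h) + f (m + h).
  by case: u_sign => ->; rewrite ?mulrN mulr1 ?opprK 1?addrC.
move=> f_m; have {f_m} : f m <=
    1 / 4 * (f (m + h) + f (m - h) + f (m + h * u) + f (m - h * u)).
  by apply: f_m; rewrite /T; lra.
lra.
Qed.
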